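(* If $|c|<(n+1)\pi/2$, then $\mathcal F_c=\{A\in\mathrm{Sym}(\mathbb R^{n+1}):\widetilde\Theta(A)\ge c\}$ is a subequation, and its dual is $\widetilde{\mathcal F_c}=\mathcal F_{-c}$.
   Context: Notation for $A=[a_{ij}]_{i,j=0}^n\in\mathrm{Sym}(\mathbb R^{n+1})$: $A^+=[a_{ij}]_{i,j=1}^n$, $I_n=\mathrm{diag}(0,1,\dots,1)$, $\mathcal S=\{A:A=\mathrm{diag}(0,A^+)\}$; $\arg$ has values in $(-\pi,\pi]$ and $\tan^{-1}$ in $(-\pi/2,\pi/2)$, applied to symmetric matrices via eigenvalues. $\widetilde\Theta(A)=\sum_{\lambda\in\mathrm{spec}(I_n+\sqrt{-1}A)}m(\lambda)\arg\lambda$ ($m$ = algebraic multiplicity) for $A\notin\mathcal S$, and $\widetilde\Theta(A)=\pi/2+\mathrm{tr}\tan^{-1}(A^+)$ for $A\in\mathcal S$. A subequation is a nonempty proper closed subset $F\subset\mathrm{Sym}(\mathbb R^m)$ with $F+\mathcal P\subseteq F$, where $\mathcal P$ is the set of positive semidefinite matrices. The dual of $F$ is $\widetilde F=\mathrm{Sym}(\mathbb R^m)\setminus(-\mathrm{Int}\,F)$. *)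

(* Defs.v *)
From Stdlib Require Import Reals Lra List Arith ClassicalEpsilon.
Open Scope R_scope.

Definition C : Type := (R * R)%type.
Definition RtoC (x : R) : C := (x, 0).
Definition C0 : C := (0, 0).
Definition C1 : C := (1, 0).
Definition Cadd (z w : C) : C := (fst z + fst w, snd z + snd w).
Definition Copp (z : C) : C := (- fst z, - snd z).
Definition Csub (z w : C) : C := Cadd z (Copp w).
Definition Cmul (z w : C) : C :=
  (fst z * fst w - snd z * snd w, fst z * snd w + snd z * fst w).

(** Principal argument with values in (-PI, PI]; convention arg 0 = 0. *)
Definition Carg (z : C) : R :=
  let x := fst z in let y := snd z in
  if Rlt_dec 0 x then atan (y / x)
  else if Rlt_dec x 0 then
    (if Rle_dec 0 y then atan (y / x) + PI else atan (y / x) - PI)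
  else if Rlt_dec 0 y then PI / 2
  else if Rlt_dec y 0 then - (PI / 2)
  else 0.

Fixpoint Rsum (m : nat) (f : nat -> R) : R :=
  match m with O => 0 | S k => Rsum k f + f k end.
Fixpoint Csum (m : nat) (f : nat -> C) : C :=
  match m with O => C0 | S k => Cadd (Csum k f) (f k) end.
Definition Cprod (l : list C) : C := fold_right Cmul C1 l.

(** * Matrices: entries indexed by nat; an (N x N) matrix uses indices 0..N-1 *)
Definition Mat : Type := nat -> nat -> R.
Definition CMat : Type := nat -> nat -> C.

Definition minor0 (j : nat) (M : CMat) : CMat :=
  fun i k => M (S i) (if Nat.ltb k j then k else S k).

Fixpoint cdet (N : nat) (M : CMat) : C :=
  match N with
  | O => C1
  | S m => Csum (S m) (fun j =>
      Cmul (if Nat.even j then C1 else Copp C1)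
           (Cmul (M 0%nat j) (cdet m (minor0 j M))))
  end.

(** l is the list of eigenvalues, with algebraic multiplicity, of the N x N
    complex matrix M: char. polynomial det(zI - M) = prod (z - lambda). *)
Definition is_eig_list (N : nat) (M : CMat) (l : list C) : Prop :=
  length l = N /\
  forall z : C,
    cdet N (fun i j => Csub (if Nat.eqb i j then z else C0) (M i j))
    = Cprod (map (fun lam => Csub z lam) l).

(** a chosen eigenvalue list (well-defined up to permutation) *)
Definition eig_list (N : nat) (M : CMat) : list C :=
  epsilon (inhabits nil) (is_eig_list N M).

Definition is_sym (n : nat) (A : Mat) : Prop :=
  forall i j, (i <= n)%nat -> (j <= n)%nat -> A i j = A j i.

(** I_n + sqrt(-1) A, where I_n = diag(0,1,...,1) *)
Definition ImA (A : Mat) : CMat :=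
  fun i j => (if andb (Nat.eqb i j) (negb (Nat.eqb i 0)) then 1 else 0, A i j).

(** A^+ = [a_ij]_{i,j=1..n}, as an n x n matrix with indices 0..n-1, viewed complex *)
Definition Aplus (A : Mat) : CMat := fun i j => RtoC (A (S i) (S j)).

Definition in_S (n : nat) (A : Mat) : Prop :=
  A 0%nat 0%nat = 0 /\
  forall j, (1 <= j <= n)%nat -> A 0%nat j = 0 /\ A j 0%nat = 0.

Definition sum_list (l : list R) : R := fold_right Rplus 0 l.

Definition Theta (n : nat) (A : Mat) : R :=
  if excluded_middle_informative (in_S n A) then
    (* pi/2 + tr arctan(A^+) = pi/2 + sum of arctan of the (real) eigenvalues of A^+ *)
    PI / 2 + sum_list (map (fun lam => atan (fst lam)) (eig_list n (Aplus A)))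
  else
    sum_list (map Carg (eig_list (S n) (ImA A))).

Definition madd (A B : Mat) : Mat := fun i j => A i j + B i j.
Definition mopp (A : Mat) : Mat := fun i j => - A i j.

Definition psd (n : nat) (P : Mat) : Prop :=
  is_sym n P /\
  forall x : nat -> R,
    0 <= Rsum (S n) (fun i => Rsum (S n) (fun j => x i * P i j * x j)).

Definition close (n : nat) (eps : R) (A B : Mat) : Prop :=
  forall i j, (i <= n)%nat -> (j <= n)%nat -> Rabs (A i j - B i j) < eps.

Definition interior (n : nat) (F : Mat -> Prop) (X : Mat) : Prop :=
  exists eps, 0 < eps /\ forall B, is_sym n B -> close n eps X B -> F B.

Definition is_closed (n : nat) (F : Mat -> Prop) : Prop :=
  forall A, is_sym n A ->
    (forall eps, 0 < eps -> exists B, F B /\ close n eps A B) -> F A.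

Definition subequation (n : nat) (F : Mat -> Prop) : Prop :=
  (forall A, F A -> is_sym n A) /\
  (exists A, F A) /\
  (exists A, is_sym n A /\ ~ F A) /\
  is_closed n F /\
  (forall A P, F A -> psd n P -> F (madd A P)).

Definition dual (n : nat) (F : Mat -> Prop) (A : Mat) : Prop :=
  is_sym n A /\ ~ interior n F (mopp A).

Definition Fc (n : nat) (c : R) (A : Mat) : Prop :=
  is_sym n A /\ Theta n A >= c.

(* Main.v *)
(** If the argument of [0] is taken to be [PI / 2], then [Theta A] is the sum of
    the arguments of the eigenvalues of [I_n + i A], all of which lie in the closed
    right half-plane, for every symmetric [A], degenerate or not. Adding [d I] to
    [A] translates these eigenvalues by [i d], so [Theta (A + d I)] decreases to
    [Theta A] as [d] decreases to [0], strictly if [n >= 1] because the real parts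
    of the eigenvalues add up to [n]. Also [Theta (- A) >= - Theta A], with equality
    off the degenerate set. Granted that [Theta] is monotone, closedness and the
    description of the dual follow by comparing a matrix [B] near [A] with [A + d I].

    For monotonicity it is enough to add a rank one matrix [k u^* u] to a Hermitian
    [H]. Put [M = D + i H] with [D >= 0] diagonal. For [s > 0] the determinant ratio
    [det (s + M + i k u^* u) / det (s + M) = 1 + i k u (s + M)^-1 u^*] lies in the
    upper half-plane. The difference of the two sums of arguments of the [s + lambda]
    is an argument of this ratio, is continuous in [s] and tends to [0] as [s] tends
    to infinity, so it stays in [(0, PI)] for all [s > 0]; no continuity of roots in
    the matrix is needed. *)
From Stdlib Require Import Reals Ranalysis5 Lra Lia List Permutation Arith.
From Stdlib Require Import ClassicalEpsilon FunctionalExtensionality.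
From mathcomp Require all_boot all_order all_algebra sesquilinear spectral.
From mathcomp Require Rstruct complex.
Require Import Defs.
Open Scope R_scope.

(** * Sums of arguments over lists of complex numbers *)

Definition ang (z : C) : R := atan (snd z / fst z).

(* Unlike [Carg], this sends [0] to [PI / 2]: with this convention [Theta] is a
   single sum over the spectrum, on and off the degenerate set. *)
Definition argp (z : C) : R :=
  if Rlt_dec 0 (fst z) then ang z
  else if Rle_dec 0 (snd z) then PI / 2 else - (PI / 2).

Definition Cconj (z : C) : C := (fst z, - snd z).

Definition lsum (f : C -> R) (l : list C) : R := sum_list (map f l).

Lemma lsum_perm (f : C -> R) (l l' : list C) :
  Permutation l l' -> lsum f l = lsum f l'.
Proof. unfold lsum; induction 1; simpl in *; lra. Qed.

Lemma lsum_map (f : C -> R) (g : C -> C) (l : list C) :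
  lsum f (map g l) = lsum (fun z => f (g z)) l.
Proof. unfold lsum; now rewrite map_map. Qed.

Lemma lsum_le (f g : C -> R) (l : list C) :
  (forall z, In z l -> f z <= g z) -> lsum f l <= lsum g l.
Proof.
  unfold lsum; induction l as [|a l IH]; simpl; intros H; [lra|].
  assert (f a <= g a) by auto. assert (sum_list (map f l) <= sum_list (map g l)) by auto.
  lra.
Qed.

Lemma lsum_eq (f g : C -> R) (l : list C) :
  (forall z, In z l -> f z = g z) -> lsum f l = lsum g l.
Proof. intros H; apply Rle_antisym; apply lsum_le; intros z Hz; rewrite (H z Hz); lra. Qed.

Lemma lsum_lt (f g : C -> R) (l : list C) :
  (forall z, In z l -> f z <= g z) -> (exists z, In z l /\ f z < g z) ->
  lsum f l < lsum g l.
Proof.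
  unfold lsum; induction l as [|a l IH]; simpl; intros H [z [Hz Hlt]]; [tauto|].
  assert (f a <= g a) by auto.
  assert (sum_list (map f l) <= sum_list (map g l)) by (apply lsum_le; auto).
  destruct Hz as [->|Hz]; [lra|].
  assert (sum_list (map f l) < sum_list (map g l)) by (apply IH; eauto). lra.
Qed.

Lemma lsum_cst (c : R) (l : list C) : lsum (fun _ => c) l = INR (length l) * c.
Proof.
  unfold lsum; induction l as [|a l IH]; [simpl; lra|].
  cbn [map length]. cbn [sum_list fold_right]. fold (sum_list (map (fun _ : C => c) l)).
  rewrite IH, S_INR. lra.
Qed.

Lemma lsum_opp (f : C -> R) (l : list C) : lsum (fun z => - f z) l = - lsum f l.
Proof. unfold lsum; induction l as [|a l IH]; simpl; lra. Qed.

(** * Conjugation and vertical translation in the closed right half-plane *)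

Lemma atan_inv_neg (x : R) : x < 0 -> atan x = - (PI / 2) - atan (/ x).
Proof.
  intros Hx. pose proof (atan_inv (- x)) as H.
  rewrite Rinv_opp, !atan_opp in H. specialize (H ltac:(lra)). lra.
Qed.

Lemma atan_inv_pos (x : R) : 0 < x -> atan x = PI / 2 - atan (/ x).
Proof. intros Hx. rewrite (atan_inv x Hx). lra. Qed.

Lemma Carg_argp (z : C) : 0 <= fst z -> z <> C0 -> Carg z = argp z.
Proof.
  destruct z as [x y]; unfold Carg, argp, ang, C0; simpl; intros Hx Hz.
  destruct (Rlt_dec 0 x); [easy|].
  destruct (Rlt_dec x 0); [lra|].
  destruct (Rlt_dec 0 y), (Rle_dec 0 y), (Rlt_dec y 0); try lra.
  exfalso; apply Hz; f_equal; lra.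
Qed.

Lemma argp_conj (z : C) : z <> C0 -> 0 <= fst z -> argp (Cconj z) = - argp z.
Proof.
  destruct z as [x y]; unfold argp, ang, Cconj, C0; simpl; intros Hz Hx.
  destruct (Rlt_dec 0 x).
  - replace (- y / x) with (- (y / x)) by (field; lra). apply atan_opp.
  - destruct (Rle_dec 0 y), (Rle_dec 0 (- y)); try lra.
    exfalso; apply Hz; f_equal; lra.
Qed.

(** Equality fails only at the origin, where both arguments are [PI / 2]; hence [Theta] is odd away
    from the eigenvalue [0], and in general only an inequality survives. *)
Lemma argp_conj_ge (z : C) : 0 <= fst z -> - argp z <= argp (Cconj z).
Proof.
  intros Hx. destruct (excluded_middle_informative (z = C0)) as [->|Hz].
  - unfold argp, ang, Cconj, C0; simpl. pose proof PI_RGT_0.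
    destruct (Rlt_dec 0 0); [lra|]. destruct (Rle_dec 0 0), (Rle_dec 0 (- 0)); lra.
  - rewrite argp_conj by easy. lra.
Qed.

Lemma argp_shift_le (z : C) (d : R) :
  0 <= fst z -> 0 <= d -> argp z <= argp (Cadd (0, d) z).
Proof.
  destruct z as [x y]; unfold argp, ang, Cadd; simpl; intros Hx Hd.
  pose proof PI_RGT_0. replace (0 + x) with x by lra.
  destruct (Rlt_dec 0 x).
  - destruct (Req_dec d 0) as [->|]; [right; do 2 f_equal; lra|].
    left; apply atan_increasing. apply Rmult_lt_compat_r; [now apply Rinv_0_lt_compat|lra].
  - destruct (Rle_dec 0 y), (Rle_dec 0 (d + y)); lra.
Qed.

Lemma argp_shift_lt (z : C) (d : R) :
  0 < fst z -> 0 < d -> argp z < argp (Cadd (0, d) z).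
Proof.
  destruct z as [x y]; unfold argp, ang, Cadd; simpl; intros Hx Hd.
  replace (0 + x) with x by lra. destruct (Rlt_dec 0 x); [|lra].
  apply atan_increasing. apply Rmult_lt_compat_r; [now apply Rinv_0_lt_compat|lra].
Qed.

Lemma argp_shift_pinfty (z : C) (eta : R) : 0 < eta ->
  exists T, forall t, T <= t -> PI / 2 - eta < argp (Cadd (0, t) z).
Proof.
  intros Heta. destruct z as [x y]; unfold argp, ang, Cadd; simpl.
  pose proof PI_RGT_0. pose proof PI2_1.
  (* The cap by [1] keeps [PI / 2 - e / 2] inside the range of [atan]; the halving makes the final
     inequality strict. *)
  set (e := Rmin eta 1). assert (0 < e <= 1) by (unfold e, Rmin; destruct (Rle_dec eta 1); lra).
  assert (He : e <= eta) by apply Rmin_l.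
  exists (Rmax (- y) (x * tan (PI / 2 - e / 2) - y)). intros t Ht.
  assert (- y <= t) by (eapply Rle_trans; [apply Rmax_l|exact Ht]).
  assert (x * tan (PI / 2 - e / 2) - y <= t) by (eapply Rle_trans; [apply Rmax_r|exact Ht]).
  replace (0 + x) with x by lra.
  destruct (Rlt_dec 0 x).
  - assert (tan (PI / 2 - e / 2) <= (t + y) / x).
    { apply Rmult_le_reg_l with x; [easy|]. replace (x * ((t + y) / x)) with (t + y) by (field; lra). lra. }
    assert (atan (tan (PI / 2 - e / 2)) <= atan ((t + y) / x)).
    { destruct (Req_dec (tan (PI / 2 - e / 2)) ((t + y) / x)) as [->|]; [lra|].
      left; apply atan_increasing; lra. }
    rewrite atan_tan in *; lra.
  - destruct (Rle_dec 0 (t + y)); lra.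
Qed.

Lemma argp_shift_minfty (z : C) (eta : R) : 0 < eta -> 0 <= fst z ->
  exists T, forall t, T <= t -> argp (Cadd (0, - t) z) < - (PI / 2) + eta.
Proof.
  intros Heta Hz. destruct (argp_shift_pinfty (Cconj z) eta Heta) as [T HT].
  (* The bound [snd z + 1] puts the translate strictly below the real axis, away from the origin,
     where [argp_conj] fails. *)
  exists (Rmax T (snd z + 1)). intros t Ht.
  assert (snd z + 1 <= t) by (eapply Rle_trans; [apply Rmax_r|exact Ht]).
  specialize (HT t ltac:(eapply Rle_trans; [apply Rmax_l|exact Ht])).
  replace (Cadd (0, t) (Cconj z)) with (Cconj (Cadd (0, - t) z)) in HT.
  - rewrite argp_conj in HT; [lra| |unfold Cadd; simpl; lra].
    unfold Cadd, C0; intros E; injection E; lra.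
  - unfold Cconj, Cadd; simpl; f_equal; ring.
Qed.

Lemma lsum_shift_pinfty (l : list C) (eta : R) : 0 < eta ->
  exists T, forall t, T <= t ->
    INR (length l) * (PI / 2) - eta < lsum (fun z => argp (Cadd (0, t) z)) l.
Proof.
  unfold lsum; revert eta; induction l as [|a l IH]; intros eta Heta.
  - exists 0; simpl; intros; lra.
  - destruct (IH (eta / 2)) as [T1 H1]; [lra|].
    destruct (argp_shift_pinfty a (eta / 2)) as [T2 H2]; [lra|].
    exists (Rmax T1 T2); intros t Ht.
    specialize (H1 t ltac:(eapply Rle_trans; [apply Rmax_l|exact Ht])).
    specialize (H2 t ltac:(eapply Rle_trans; [apply Rmax_r|exact Ht])).
    cbn [length]. rewrite S_INR. cbn. unfold sum_list in H1. lra.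
Qed.

Lemma lsum_shift_minfty (l : list C) (eta : R) : 0 < eta ->
  Forall (fun z => 0 <= fst z) l ->
  exists T, forall t, T <= t ->
    lsum (fun z => argp (Cadd (0, - t) z)) l < - (INR (length l) * (PI / 2)) + eta.
Proof.
  unfold lsum; intros Heta Hl; revert eta Heta.
  induction Hl as [|a l Ha Hl IH]; intros eta Heta.
  - exists 0; simpl; intros; lra.
  - destruct (IH (eta / 2)) as [T1 H1]; [lra|].
    destruct (argp_shift_minfty a (eta / 2)) as [T2 H2]; [lra|easy|].
    exists (Rmax T1 T2); intros t Ht.
    specialize (H1 t ltac:(eapply Rle_trans; [apply Rmax_l|exact Ht])).
    specialize (H2 t ltac:(eapply Rle_trans; [apply Rmax_r|exact Ht])).
    cbn [length]. rewrite S_INR. cbn. unfold sum_list in H1. lra.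
Qed.

(** * Limits from the right *)

Lemma right_limit_of_continuous (f g : R -> R) (d0 : R) :
  0 < d0 -> continuity_pt g 0 -> (forall d, 0 < d < d0 -> f d = g d) ->
  limit1_in f (Rlt 0) (g 0) 0.
Proof.
  intros Hd0 Hg Hfg eps Heps. destruct (Hg eps Heps) as [a [Ha H]].
  exists (Rmin a d0). split; [now apply Rmin_pos|].
  intros x [Hx Hd]. simpl in *. unfold Rdist in *.
  assert (Rabs (x - 0) < a) by (eapply Rlt_le_trans; [exact Hd|apply Rmin_l]).
  assert (Rabs (x - 0) < d0) by (eapply Rlt_le_trans; [exact Hd|apply Rmin_r]).
  assert (x < d0) by (rewrite Rabs_right in *; lra).
  rewrite Hfg by lra. apply H. repeat split; [lra|easy].
Qed.

Lemma limit_le (f g : R -> R) (a b : R) :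
  limit1_in f (Rlt 0) a 0 -> limit1_in g (Rlt 0) b 0 ->
  (forall d, 0 < d -> f d <= g d) -> a <= b.
Proof.
  intros Hf Hg H. apply Rnot_lt_le; intros Hlt.
  destruct (Hf ((a - b) / 2)) as [d1 [Hd1 H1]]; [lra|].
  destruct (Hg ((a - b) / 2)) as [d2 [Hd2 H2]]; [lra|].
  simpl in *. unfold Rdist in *.
  set (d := Rmin d1 d2 / 2). assert (0 < Rmin d1 d2) by now apply Rmin_pos.
  pose proof (Rmin_l d1 d2). pose proof (Rmin_r d1 d2).
  assert (0 < d) by (unfold d; lra).
  assert (Rabs (d - 0) < Rmin d1 d2) by (rewrite Rabs_right; unfold d in *; lra).
  specialize (H1 d ltac:(split; lra)). specialize (H2 d ltac:(split; lra)).
  specialize (H d ltac:(easy)).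
  apply Rabs_def2 in H1. apply Rabs_def2 in H2. lra.
Qed.

Lemma limit_lsum (f : R -> C -> R) (g : C -> R) (l : list C) :
  (forall z, In z l -> limit1_in (fun d => f d z) (Rlt 0) (g z) 0) ->
  limit1_in (fun d => lsum (f d) l) (Rlt 0) (lsum g l) 0.
Proof.
  unfold lsum; induction l as [|a l IH]; simpl; intros H.
  - apply (right_limit_of_continuous _ (fun _ => 0) 1); [lra| |easy].
    now apply continuity_pt_const.
  - apply limit_plus; auto.
Qed.

Lemma continuity_pt_atan (f : R -> R) (x : R) :
  continuity_pt f x -> continuity_pt (fun t => atan (f t)) x.
Proof.
  intros H. apply (continuity_pt_comp f atan); [easy|].
  apply derivable_continuous_pt. apply derivable_pt_atan.
Qed.

(** At its jump on the imaginary axis [argp] takes the upper value, so it is continuous from above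
    there; below the origin it stays [- (PI / 2)] as long as [d < - y]. *)
Lemma limit_argp_shift (z : C) : 0 <= fst z ->
  limit1_in (fun d => argp (Cadd (0, d) z)) (Rlt 0) (argp z) 0.
Proof.
  destruct z as [x y]; unfold argp, ang, Cadd; simpl; intros Hx.
  replace (0 + x) with x by lra.
  destruct (Rlt_dec 0 x).
  - replace (atan (y / x)) with (atan ((0 + y) / x)) by (do 2 f_equal; lra).
    apply (right_limit_of_continuous _ (fun d => atan ((d + y) / x)) 1); [lra| |easy].
    apply continuity_pt_atan. reg.
  - destruct (Rle_dec 0 y).
    + apply (right_limit_of_continuous _ (fun _ => PI / 2) 1); [lra| |].
      * now apply continuity_pt_const.
      * intros d Hd. destruct (Rle_dec 0 (d + y)); lra.
    + apply (right_limit_of_continuous _ (fun _ => - (PI / 2)) (- y)); [lra| |].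
      * now apply continuity_pt_const.
      * intros d Hd. destruct (Rle_dec 0 (d + y)); lra.
Qed.

(* Moving along the curve [d^2 + i d], which is tangent to the imaginary axis,
   selects the value [PI / 2] of [argp] at the origin. *)
Lemma limit_ang_curve (z : C) : 0 <= fst z ->
  limit1_in (fun d => ang (Cadd (d * d, 0) (Cadd (0, d) z))) (Rlt 0) (argp z) 0.
Proof.
  destruct z as [x y]; unfold argp, ang, Cadd; simpl; intros Hx.
  destruct (Rlt_dec 0 x).
  - replace (atan (y / x)) with (atan ((0 + (0 + y)) / (0 * 0 + (0 + x)))) by (do 2 f_equal; lra).
    apply (right_limit_of_continuous _ (fun d => atan ((0 + (d + y)) / (d * d + (0 + x)))) 1);
      [lra| |easy].
    apply continuity_pt_atan. reg; lra.
  - assert (x = 0) by lra; subst x.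
    (* For [x = 0] the argument of [atan] is [(d + y) / d^2], unbounded near [0]. Its reciprocal
       tends to [0], and the inversion formulas for [atan] pass from one to the other. *)
    assert (E : forall d, 0 < d -> d + y <> 0 ->
      / ((0 + (d + y)) / (d * d + (0 + 0))) = d * d / (d + y)).
    { intros d Hd Hy. field. repeat split; lra || nra. }
    assert (HS : forall d, 0 < d -> 0 < / (d * d + (0 + 0))).
    { intros d Hd. apply Rinv_0_lt_compat. nra. }
    destruct (Rle_dec 0 y) as [Hy|Hy].
    + destruct (Req_dec y 0) as [->|Hy0].
      * replace (PI / 2) with (PI / 2 - atan 0) by (rewrite atan_0; lra).
        apply (right_limit_of_continuous _ (fun d => PI / 2 - atan d) 1); [lra| |].
        { apply continuity_pt_minus; [now apply continuity_pt_const|].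
          apply continuity_pt_atan. reg. }
        intros d Hd. rewrite atan_inv_pos.
        { rewrite E by lra. do 2 f_equal. field; lra. }
        apply Rmult_lt_0_compat; [lra|apply HS; lra].
      * replace (PI / 2) with (PI / 2 - atan (0 * 0 / (0 + y)))
          by (replace (0 * 0 / (0 + y)) with 0 by (field; lra); rewrite atan_0; lra).
        apply (right_limit_of_continuous _ (fun d => PI / 2 - atan (d * d / (d + y))) 1); [lra| |].
        { apply continuity_pt_minus; [now apply continuity_pt_const|].
          apply continuity_pt_atan. reg; lra. }
        intros d Hd. rewrite atan_inv_pos, E by (lra || (apply Rmult_lt_0_compat; [lra|apply HS; lra])).
        easy.
    + replace (- (PI / 2)) with (- (PI / 2) - atan (0 * 0 / (0 + y)))
          by (replace (0 * 0 / (0 + y)) with 0 by (field; lra); rewrite atan_0; lra).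
      apply (right_limit_of_continuous _ (fun d => - (PI / 2) - atan (d * d / (d + y))) (- y)); [lra| |].
      { apply continuity_pt_minus; [now apply continuity_pt_const|].
        apply continuity_pt_atan. reg; lra. }
      intros d Hd. rewrite atan_inv_neg; [now rewrite E by lra|].
      pose proof (HS d ltac:(lra)). unfold Rdiv. nra.
Qed.

(** * Polar form of products and comparison of two spectra *)

Lemma Cprod_polar (l : list C) : Forall (fun z => 0 < fst z) l ->
  exists r, 0 < r /\
    Cprod l = (r * cos (lsum ang l), r * sin (lsum ang l)).
Proof.
  unfold lsum; induction 1 as [|a l Ha Hl [r [Hr E]]]; simpl.
  - exists 1. split; [lra|]. rewrite cos_0, sin_0. unfold C1; f_equal; ring.
  - destruct a as [x y]; simpl in Ha. unfold ang at 1 3; simpl.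
    set (t := sum_list (map ang l)) in *. set (a := atan (y / x)).
    assert (Hc : 0 < cos a) by (apply cos_gt_0; unfold a; destruct (atan_bound (y / x)); lra).
    (* [x / cos a] is the modulus of [x + i y]. *)
    exists (r * (x / cos a)). split.
    { apply Rmult_lt_0_compat; [easy|]. now apply Rdiv_lt_0_compat. }
    assert (Ht : sin a = y / x * cos a).
    { rewrite <- (tan_atan (y / x)). fold a. unfold tan. field. lra. }
    fold (Cprod l). unfold Cmul; rewrite E; simpl. fold t. rewrite cos_plus, sin_plus, Ht.
    f_equal; field; lra.
Qed.

Lemma lsum_ang_infty (l : list C) (eta : R) : 0 < eta ->
  exists T, forall s, T <= s -> Rabs (lsum (fun z => ang (Cadd (s, 0) z)) l) < eta.
Proof.
  unfold lsum; revert eta; induction l as [|[x y] l IH]; intros eta Heta; simpl.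
  - exists 0; intros; rewrite Rabs_R0; lra.
  - destruct (IH (eta / 2)) as [T1 H1]; [lra|].
    assert (Hc : continuity_pt atan 0).
    { apply derivable_continuous_pt, derivable_pt_atan. }
    destruct (Hc (eta / 2)) as [a [Ha H2]]; [lra|].
    simpl in H2. unfold Rdist in H2.
    (* Beyond this bound [s + x > Rabs y / a], so [y / (s + x)] lies within [a] of [0]. *)
    exists (Rmax T1 (Rabs y / a - x + 1)). intros s Hs.
    specialize (H1 s ltac:(eapply Rle_trans; [apply Rmax_l|exact Hs])).
    assert (Hs2 : Rabs y / a - x + 1 <= s) by (eapply Rle_trans; [apply Rmax_r|exact Hs]).
    assert (Rabs (ang (Cadd (s, 0) (x, y))) < eta / 2).
    { unfold ang, Cadd; simpl. replace (0 + y) with y by lra.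
      destruct (Req_dec (y / (s + x)) 0) as [->|Hne]; [rewrite atan_0, Rabs_R0; lra|].
      specialize (H2 (y / (s + x))). rewrite atan_0, !Rminus_0_r in H2.
      apply H2. repeat split; [lra|].
      assert (0 <= Rabs y / a).
      { apply Rmult_le_pos; [apply Rabs_pos|]. left; now apply Rinv_0_lt_compat. }
      unfold Rdiv at 1. rewrite Rabs_mult, (Rabs_right (/ (s + x)))
        by (left; apply Rinv_0_lt_compat; lra).
      apply Rmult_lt_reg_r with (s + x); [lra|].
      replace (Rabs y * / (s + x) * (s + x)) with (Rabs y) by (field; lra).
      replace (Rabs y) with (a * (Rabs y / a)) by (field; lra). nra. }
    eapply Rle_lt_trans; [apply Rabs_triang|]. lra.
Qed.

Lemma continuity_lsum_ang (l : list C) (s : R) : 0 < s ->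
  Forall (fun z => 0 <= fst z) l ->
  continuity_pt (fun s => lsum (fun z => ang (Cadd (s, 0) z)) l) s.
Proof.
  unfold lsum; intros Hs; induction 1 as [|[x y] l Hx Hl IH]; simpl.
  - now apply continuity_pt_const.
  - apply continuity_pt_plus; [|exact IH]. unfold ang, Cadd; simpl in *.
    apply continuity_pt_atan. reg; lra.
Qed.

(* The angle difference [g] is continuous in [s], vanishes at infinity, and
   avoids [- PI] because [sin g > 0]; hence it cannot leave [(0, PI)]. *)
Lemma lsum_ang_lt (l l' : list C) :
  Forall (fun z => 0 <= fst z) l -> Forall (fun z => 0 <= fst z) l' ->
  (forall s, 0 < s ->
    0 < snd (Cmul (Cprod (map (Cadd (s, 0)) l'))
                  (Cconj (Cprod (map (Cadd (s, 0)) l))))) ->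
  forall s, 0 < s ->
    lsum (fun z => ang (Cadd (s, 0) z)) l < lsum (fun z => ang (Cadd (s, 0) z)) l'.
Proof.
  intros Hl Hl' Him.
  set (f := fun s => lsum (fun z => ang (Cadd (s, 0) z)) l).
  set (f' := fun s => lsum (fun z => ang (Cadd (s, 0) z)) l').
  assert (Hshift : forall m s, 0 < s -> Forall (fun z => 0 <= fst z) m ->
    Forall (fun z => 0 < fst z) (map (Cadd (s, 0)) m)).
  { intros m s Hs Hm. apply Forall_map. revert Hm. apply Forall_impl.
    intros z Hz; unfold Cadd; simpl; lra. }
  assert (Hsin : forall s, 0 < s -> 0 < sin (f' s - f s)).
  { intros s Hs. specialize (Him s Hs).
    destruct (Cprod_polar _ (Hshift l s Hs Hl)) as [r [Hr E]].
    destruct (Cprod_polar _ (Hshift l' s Hs Hl')) as [r' [Hr' E']].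
    rewrite E, E', !lsum_map in Him. fold (f s) in Him. fold (f' s) in Him.
    unfold Cmul, Cconj in Him; simpl in Him. rewrite sin_minus.
    assert (0 < r * r') by now apply Rmult_lt_0_compat.
    apply Rmult_lt_reg_l with (r * r'); [easy|]. lra. }
  intros s Hs. change (f s < f' s). apply Rnot_le_lt; intros Hle.
  pose proof PI_RGT_0. pose proof PI2_1.
  (* On [(- PI, 0]] the sine is nonpositive, so a difference that is at most [0] is already at most
     [- PI]. *)
  assert (Hpi : f' s - f s <= - PI).
  { apply Rnot_lt_le; intros Hlt. specialize (Hsin s Hs).
    assert (0 <= sin (- (f' s - f s))) by (apply sin_ge_0; lra).
    rewrite sin_neg in *. lra. }
  destruct (lsum_ang_infty l 1 ltac:(lra)) as [T HT].
  destruct (lsum_ang_infty l' 1 ltac:(lra)) as [T' HT'].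
  (* At [s'] both sums are below [1] in absolute value, so their difference exceeds [- 2 > - PI],
     and the intermediate value theorem on [[s, s']] applies. *)
  set (s' := Rmax (Rmax T T') (s + 1)).
  assert (Hs' : s + 1 <= s') by apply Rmax_r.
  assert (HTT : Rmax T T' <= s') by apply Rmax_l.
  pose proof (Rmax_l T T'). pose proof (Rmax_r T T').
  specialize (HT s' ltac:(lra)). specialize (HT' s' ltac:(lra)).
  fold (f s') in HT. fold (f' s') in HT'.
  apply Rabs_def2 in HT. apply Rabs_def2 in HT'.
  assert (Hsin0 : forall t, 0 < t -> f' t - f t + PI <> 0).
  { intros t Ht E. specialize (Hsin t Ht). replace (f' t - f t) with (- PI) in Hsin by lra.
    rewrite sin_neg, sin_PI in Hsin. lra. }
  destruct (IVT_interv (fun t => f' t - f t + PI) s s') as [t [Ht E]].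
  - intros t Ht. apply continuity_pt_plus; [|now apply continuity_pt_const].
    apply continuity_pt_minus; apply continuity_lsum_ang; easy || lra.
  - lra.
  - pose proof (Hsin0 s Hs). lra.
  - lra.
  - apply (Hsin0 t); lra.
Qed.

(** * Spectra of matrices with positive semidefinite real part *)

Module Spectrum.
Import all_boot all_order all_algebra sesquilinear spectral Rstruct complex.
Import Order.TTheory GRing.Theory Num.Theory.
Import Defs.
Set Implicit Arguments. Unset Strict Implicit. Unset Printing Implicit Defensive.
Local Open Scope ring_scope.

Local Notation adj M := (map_mx Num.conj M^T).
Local Notation herm H := (adj H = H).

(** * Eigenvalues, quadratic forms and rank one perturbations over a closed field *)

Section ClosedField.
Variable K : numClosedFieldType.
Implicit Types (x y z k s : K) (l : seq K).

(** Phrased through values of the characteristic polynomial to match [is_eig_list]; [eigsP] upgrades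
    it to an identity of polynomials. *)
Definition eigs N (M : 'M[K]_N) l : Prop :=
  size l = N /\ forall z, \det (z%:M - M) = \prod_(x <- l) (z - x).

(** In characteristic zero the naturals below [size (p - q)] are distinct, and a nonzero [p - q]
    cannot have that many roots. *)
Lemma poly_eq_fun (p q : {poly K}) : (forall z, p.[z] = q.[z]) -> p = q.
Proof.
move=> pq; apply/eqP; rewrite -subr_eq0; apply/negPn/negP => nz.
pose rs : seq K := [seq i%:R | i <- iota 0 (size (p - q))].
have: (size rs < size (p - q)%R)%N.
  apply: max_poly_roots => //.
    by apply/allP => z _; rewrite /root hornerD hornerN pq subrr.
  by rewrite map_inj_uniq ?iota_uniq // => i j /eqP; rewrite eqr_nat => /eqP.
by rewrite size_map size_iota ltnn.
Qed.

Lemma horner_char_poly N (M : 'M[K]_N) z : (char_poly M).[z] = \det (z%:M - M).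
Proof.
rewrite -horner_evalE /char_poly -det_map_mx; congr (\det _).
by apply/matrixP=> i j; rewrite !mxE /= /horner_eval hornerD hornerN hornerC hornerMn hornerX.
Qed.

Lemma eigsP N (M : 'M[K]_N) l :
  eigs M l <-> char_poly M = \prod_(x <- l) ('X - x%:P).
Proof.
have hp z : (\prod_(x <- l) ('X - x%:P)).[z] = \prod_(x <- l) (z - x).
  by rewrite horner_prod; apply: eq_bigr => x _; rewrite hornerXsubC.
split=> [[_ e]|e]; first by apply: poly_eq_fun => z; rewrite horner_char_poly e hp.
split=> [|z]; last by rewrite -horner_char_poly e hp.
by apply: succn_inj; rewrite -(size_char_poly M) e size_prod_XsubC.
Qed.

Lemma eigs_exists N (M : 'M[K]_N) : exists l, eigs M l.
Proof.
have [l e] := closed_field_poly_normal (char_poly M).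
by exists l; apply/eigsP; rewrite e (monicP (char_poly_monic M)) scale1r.
Qed.

Lemma eigs_perm N (M : 'M[K]_N) l l' : eigs M l -> eigs M l' -> perm_eq l l'.
Proof. by move=> /eigsP e /eigsP e'; apply: prod_XsubC_eq; rewrite -e -e'. Qed.

Lemma eigs_vec N (M : 'M[K]_N) l x : eigs M l -> x \in l ->
  exists2 v : 'rV[K]_N, v != 0 & v *m M = x *: v.
Proof.
case=> _ e xl; have /eqP: \det (x%:M - M) = 0.
  by rewrite e; apply/eqP; rewrite prodf_seq_eq0; apply/hasP; exists x; rewrite ?subrr ?eqxx.
case/det0P=> v v0 ve; exists v => //; apply/esym/eqP.
by rewrite -subr_eq0 -mul_mx_scalar -mulmxBr ve.
Qed.

(** Comes from [det (z - a - b M) = b^N det ((z - a) / b - M)], with one factor [b] given to each of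
    the [N] linear factors. *)
Lemma eigs_affine N (M : 'M[K]_N) l a b : b != 0 -> eigs M l ->
  eigs (a%:M + b *: M) [seq a + b * x | x <- l].
Proof.
move=> b0 [sl e]; split=> [|z]; first by rewrite size_map.
have -> : z%:M - (a%:M + b *: M) = b *: (((z - a) / b)%:M - M).
  by rewrite scalerBr scale_scalar_mx mulrC divfK // opprD addrA raddfB.
rewrite detZ e big_map -{}sl.
elim: l {e} => [|x l ih]; first by rewrite !big_nil mulr1.
rewrite !big_cons /= exprS mulrACA ih; congr (_ * _).
by rewrite mulrBr mulrC divfK // opprD addrA.
Qed.

Lemma eigs_conj N (M : 'M[K]_N) l : eigs M l ->
  eigs (map_mx Num.conj M) [seq x^* | x <- l].
Proof.
case=> sl e; split=> [|z]; first by rewrite size_map.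
have -> : z%:M - map_mx Num.conj M = map_mx Num.conj ((z^*)%:M - M).
  by rewrite raddfB /= map_scalar_mx /= conjCK.
rewrite det_map_mx e big_map rmorph_prod.
by apply: eq_bigr => x _; rewrite rmorphB /= conjCK.
Qed.

Lemma eigs_tr N (M : 'M[K]_N) l : eigs M l -> \sum_(x <- l) x = \tr M.
Proof.
case: N M => [|N] M h; have sl := h.1.
  by case: l sl {h} => //; rewrite big_nil /mxtrace big_ord0.
move/eigsP: h => h; apply: oppr_inj; rewrite -char_poly_trace // h /=.
have := @coefPn_prod_XsubC K l; rewrite sl => -> //.
Qed.

Lemma herm_form_real N (H : 'M[K]_N) (v : 'rV[K]_N) : herm H ->
  (v *m H *m adj v) 0 0 \is Num.real.
Proof.
move=> hH; apply/CrealP.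
have e : adj (v *m H *m adj v) = v *m H *m adj v.
  rewrite !trmx_mul !map_mxM /= hH mulmxA; congr (_ *m _ *m _).
  by apply/matrixP => i j; rewrite !mxE conjCK.
by rewrite -{2}e !mxE.
Qed.

(** A Hermitian [H] has a real form, so ['i *: H] contributes only to the imaginary part. *)
Lemma form_Re N (d : 'rV[K]_N) (H : 'M[K]_N) (v : 'rV[K]_N) :
  (forall i, d 0 i \is Num.real) -> herm H ->
  'Re ((v *m (diag_mx d + 'i *: H) *m adj v) 0 0) = \sum_i d 0 i * `|v 0 i| ^+ 2.
Proof.
move=> hd hH; rewrite mulmxDr mulmxDl -scalemxAr -scalemxAl mxE [X in _ + X]mxE raddfD /=.
have -> : 'Re ('i * (v *m H *m adj v) 0 0) = 0.
  by rewrite ReMil (Creal_ImP _ _) ?oppr0 ?herm_form_real.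
rewrite addr0 mul_mx_diag mxE raddf_sum; apply: eq_bigr => i _.
rewrite !mxE /= mulrAC -normCK mulrC.
by apply/Creal_ReP; rewrite rpredM // rpredX // normr_real.
Qed.

(** Evaluates the form at a row eigenvector. This places the spectrum in the right half-plane,
    describes the eigenvectors for [0] and, with [d = 0], shows that [A^+] has real spectrum. *)
Lemma form_Re_eigs N (d : 'rV[K]_N) (H : 'M[K]_N) (v : 'rV[K]_N) x :
  (forall i, d 0 i \is Num.real) -> herm H ->
  v *m (diag_mx d + 'i *: H) = x *: v ->
  'Re x * \sum_i `|v 0 i| ^+ 2 = \sum_i d 0 i * `|v 0 i| ^+ 2.
Proof.
move=> hd hH e; rewrite -(form_Re v hd hH) e -scalemxAl mxE.
have -> : (v *m adj v) 0 0 = \sum_i `|v 0 i| ^+ 2.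
  by rewrite mxE; apply: eq_bigr => i _; rewrite !mxE normCK.
have r : \sum_i `|v 0 i| ^+ 2 \is Num.real.
  by apply: rpred_sum => i _; rewrite rpredX // normr_real.
by rewrite ReM (Creal_ReP _ r) (Creal_ImP _ r) mulr0 subr0.
Qed.

Lemma sum_sqr_gt0 N (v : 'rV[K]_N) : v != 0 -> 0 < \sum_i `|v 0 i| ^+ 2.
Proof.
move=> v0; rewrite lt_def sumr_ge0 ?andbT; last by move=> i _; rewrite exprn_ge0.
apply: contra v0; rewrite psumr_eq0; last by move=> i _; rewrite exprn_ge0.
move=> /allP h; apply/eqP/rowP => i; rewrite mxE; apply/eqP.
by have := h i (mem_index_enum _); rewrite expf_eq0 /= normr_eq0.
Qed.

Lemma weighted_sum_sqr_gt0 N (d : 'rV[K]_N) (v : 'rV[K]_N) :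
  (forall i, 0 < d 0 i) -> v != 0 -> 0 < \sum_i d 0 i * `|v 0 i| ^+ 2.
Proof.
move=> hd /sum_sqr_gt0; rewrite !lt_def => /andP[nz _].
rewrite sumr_ge0 ?andbT; last by move=> i _; rewrite mulr_ge0 ?exprn_ge0 // ltW.
apply: contra nz; rewrite !psumr_eq0; first last.
- by move=> i _; rewrite mulr_ge0 ?exprn_ge0 // ltW.
- by move=> i _; rewrite exprn_ge0.
move=> /allP h; apply/allP => i /h /=.
by rewrite mulf_eq0 gt_eqF.
Qed.

Lemma eigs_Re_ge0 N (d : 'rV[K]_N) (H : 'M[K]_N) l x :
  (forall i, 0 <= d 0 i) -> herm H -> eigs (diag_mx d + 'i *: H) l -> x \in l ->
  0 <= 'Re x.
Proof.
move=> hd hH hl xl; have [v v0 e] := eigs_vec hl xl.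
have := form_Re_eigs (fun i => ger0_real (hd i)) hH e.
rewrite -(pmulr_lge0 _ (sum_sqr_gt0 v0)) => ->.
by rewrite sumr_ge0 // => i _; rewrite mulr_ge0 // exprn_ge0.
Qed.

(** The two sides come from a lower-upper and an upper-lower factorization of the block matrix with
    rows [1, - r] and [c, 1]. *)
Lemma det_addr_rank1 N (c : 'cV[K]_N) (r : 'rV[K]_N) :
  \det (1%:M + c *m r) = 1 + (r *m c) 0 0.
Proof.
have e1 : block_mx 1%:M 0 c 1%:M *m block_mx 1%:M (- r) 0 (1%:M + c *m r)
        = block_mx 1%:M (- r) c 1%:M :> 'M_(1 + N).
  rewrite mulmx_block !mulmx1 !mul1mx !mul0mx ?mulmx0 !addr0 mulmxN.
  by rewrite addrC -addrA subrr addr0.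
have e2 : block_mx 1%:M (- r) 0 1%:M *m block_mx (1%:M + r *m c) 0 c 1%:M
        = block_mx 1%:M (- r) c 1%:M :> 'M_(1 + N).
  rewrite mulmx_block !mulmx1 !mul1mx !mul0mx ?mulmx0 !add0r mulNmx.
  by rewrite -addrA subrr addr0.
have : \det (block_mx 1%:M 0 c 1%:M *m block_mx 1%:M (- r) 0 (1%:M + c *m r) : 'M_(1 + N))
  = \det (block_mx 1%:M (- r) 0 1%:M *m block_mx (1%:M + r *m c) 0 c 1%:M : 'M_(1 + N)).
  by rewrite e1 e2.
by rewrite !det_mulmx !det_lblock !det_ublock !det1 !mul1r !mulr1 => ->; rewrite det_mx11 !mxE eqxx.
Qed.

Lemma eigs_shift_det N (M : 'M[K]_N) l s : eigs M l ->
  \prod_(x <- l) (s + x) = \det (s%:M + M).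
Proof.
move=> hl; have n1 : -1 != 0 :> K by rewrite oppr_eq0 oner_eq0.
have [_ /(_ s)] := eigs_affine 0 n1 hl.
rewrite raddf0 add0r scaleN1r opprK big_map => ->.
by apply: eq_bigr => x _; rewrite add0r mulN1r opprK.
Qed.

(** The determinant ratio is multiplied by [|det M|^2] to avoid a division, where [M] includes the
    shift [s]; the factor left is [1 + i k u M^-1 (adj u)]. *)
Lemma rank1_Im_gt0 N (d : 'rV[K]_N) (H : 'M[K]_N) (u : 'rV[K]_N) k s l l' :
  (forall i, 0 <= d 0 i) -> herm H -> 0 < k -> u != 0 -> 0 < s ->
  eigs (diag_mx d + 'i *: H) l ->
  eigs (diag_mx d + 'i *: (H + k *: (adj u *m u))) l' ->
  0 < 'Im ((\prod_(x <- l') (s + x)) * (\prod_(x <- l) (s + x))^* ).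
Proof.
move=> hd hH k0 u0 s0 hl hl'; rewrite (eigs_shift_det s hl) (eigs_shift_det s hl').
pose M := s%:M + (diag_mx d + 'i *: H).
pose d' := const_mx s + d.
have hd' i : 0 < d' 0 i by rewrite !mxE ltr_wpDr.
have Me : M = diag_mx d' + 'i *: H.
  by rewrite /M addrA raddfD /= diag_const_mx.
have pos (v : 'rV_N) : v != 0 -> 0 < 'Re ((v *m M *m adj v) 0 0).
  by move=> v0; rewrite Me form_Re ?weighted_sum_sqr_gt0 // => i; rewrite gtr0_real.
have dM : \det M != 0.
  apply/negP => /det0P[v v0 e]; have := pos v v0.
  by rewrite e mul0mx mxE raddf0 ltxx.
have uM : M \in unitmx by rewrite unitmxE unitfE.
have -> : s%:M + (diag_mx d + 'i *: (H + k *: (adj u *m u)))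
    = M *m (1%:M + (('i * k) *: (invmx M *m adj u)) *m u).
  rewrite mulmxDr mulmx1 -scalemxAl -!scalemxAr !mulmxA mulmxV // mul1mx.
  by rewrite scalerDr scalerA /M !addrA.
rewrite det_mulmx det_addr_rank1 mulrAC -normCK -/M.
pose w := u *m invmx M.
have w0 : w != 0.
  apply: contra u0 => /eqP w0; rewrite -(mulmxKV uM u).
  by rewrite -/w w0 mul0mx.
(* Since [u = w M], the scalar [u M^-1 (adj u) = w (adj u)] is the conjugate of the form of [M] at
   [w], whose real part is positive. *)
have -> : (u *m (('i * k) *: (invmx M *m adj u))) 0 0 = 'i * k * ((w *m M *m adj w) 0 0)^*.
  rewrite -scalemxAr mxE mulmxA -/w; congr (_ * _).
  have -> : ((w *m M *m adj w) 0 0)^* = (adj (w *m M *m adj w)) 0 0 by rewrite !mxE.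
  rewrite trmx_mul map_mxM /= /w mulmxKV //; congr ((_ *m _) 0 0).
  by apply/matrixP => i j; rewrite !mxE conjCK.
have rn : `|\det M| ^+ 2 \is Num.real by rewrite rpredX // normr_real.
rewrite ImM (Creal_ImP _ rn) mulr0 addr0 (Creal_ReP _ rn).
rewrite pmulr_rgt0 ?exprn_gt0 ?normr_gt0 // raddfD /= (Creal_ImP _ (rpred1 _)) add0r.
rewrite -mulrA ImMil ReM Re_conj (Creal_ReP _ (gtr0_real k0)) (Creal_ImP _ (gtr0_real k0)).
by rewrite mul0r subr0 mulr_gt0 // pos.
Qed.

(** By the spectral theorem [P] is the sum of the [sp_i (adj u_i) u_i] over the rows [u_i] of a
    unitary matrix, and [sp_i] is the value of the form at [u_i], hence nonnegative. *)
Lemma psd_ind N (Q : 'M[K]_N -> Prop) (P : 'M[K]_N) :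
  herm P -> (forall v : 'rV_N, 0 <= (v *m P *m adj v) 0 0) ->
  (forall H k (u : 'rV_N), 0 <= k -> Q H -> Q (H + k *: (adj u *m u))) ->
  forall H, Q H -> Q (H + P).
Proof.
move=> hP pP step H QH.
have /hermitian_normalmx/orthomx_spectralP : P \is hermsymmx.
  by rewrite is_hermitianmxE expr0 scale1r hP.
set U := spectralmx P; set sp := spectral_diag P.
have uU : U \is unitarymx by apply: spectral_unitarymx.
rewrite (invmx_unitary uU) => eP.
have sp0 i : 0 <= sp 0 i.
  have := pP (row i U).
  have -> // : (row i U *m P *m adj (row i U)) 0 0 = sp 0 i.
  have -> : (row i U *m P *m adj (row i U)) 0 0 = (U *m P *m adj U) i i.
    by rewrite -!row_mul !mxE; apply: eq_bigr => j _; rewrite !mxE.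
  rewrite eP !mulmxA (unitarymxP uU) mul1mx -mulmxA (unitarymxP uU) mulmx1.
  by rewrite mxE eqxx.
have -> : P = \sum_i sp 0 i *: (adj (row i U) *m row i U).
  rewrite eP mul_mx_diag; apply/matrixP => i j; rewrite !mxE summxE; apply: eq_bigr => m _.
  by rewrite !mxE big_ord1 !mxE mulrCA mulrA.
elim/big_rec: _ H QH => [|i A _ ih] H QH; first by rewrite addr0.
by rewrite addrA; apply: ih; apply: step.
Qed.
End ClosedField.

(** * Transfer between pairs of reals and the complex field *)

Local Notation K := (complex Rdefinitions.R).

Definition toK (z : Defs.C) : K := Complex (fst z) (snd z).
Definition ofK (z : K) : Defs.C := (complex.Re z, complex.Im z).

Lemma toKK : cancel toK ofK. Proof. by case. Qed.
Lemma ofKK : cancel ofK toK. Proof. by case. Qed.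
Lemma toKD z w : toK (Cadd z w) = toK z + toK w. Proof. by []. Qed.
Lemma toKB z w : toK (Csub z w) = toK z - toK w. Proof. by []. Qed.
Lemma toKM z w : toK (Cmul z w) = toK z * toK w. Proof. by []. Qed.
Lemma toKJ z : toK (Cconj z) = (toK z)^*. Proof. by []. Qed.
Lemma toK_ReE z : 'Re (toK z) = toK (fst z, IZR 0).
Proof. by rewrite ReE -ReJ_add. Qed.
Lemma toK_i : toK (IZR 0, IZR 1) = 'i. Proof. by []. Qed.
Lemma toK_ImE z : 'Im (toK z) = toK (snd z, IZR 0).
Proof.
rewrite -[LHS]opprK -ReMil -toK_i -toKM toK_ReE.
by congr Complex; rewrite /= -RoppE; lra.
Qed.

Lemma toK_sum N (f : nat -> Defs.C) : toK (Csum N f) = \sum_(i < N) toK (f i).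
Proof. by elim: N => [|N ih]; rewrite ?big_ord0 // big_ord_recr /= toKD ih. Qed.

Lemma toK_prod l : toK (Cprod l) = \prod_(x <- map toK l) x.
Proof. by elim: l => [|x l ih]; rewrite ?big_nil //= big_cons toKM ih. Qed.

Definition mx N (M : CMat) : 'M[K]_N := \matrix_(i, j) toK (M i j).

(** Both determinants expand along the first row; it remains to match the signs, and the column
    skipped by [minor0] with [bump]. *)
Lemma toK_det N (M : CMat) : toK (cdet N M) = \det (mx N M).
Proof.
elim: N M => [|N ih] M; first by rewrite det_mx00.
have -> : cdet N.+1 M = Csum N.+1 (fun j => Cmul (if Nat.even j then C1 else Copp C1)
  (Cmul (M 0%N j) (cdet N (minor0 j M)))) by [].
rewrite (expand_det_row _ ord0) toK_sum; apply: eq_bigr => j _.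
rewrite !toKM mxE mulrCA; congr (_ * _); rewrite /cofactor add0n; congr (_ * _).
  have -> : Nat.even j = ~~ odd j.
    by elim: (nat_of_ord j) => // k; rewrite PeanoNat.Nat.even_succ -PeanoNat.Nat.negb_even => -> /=.
  by rewrite -signr_odd; case: (odd j).
rewrite ih; congr (\det _); apply/matrixP => i k; rewrite !mxE /minor0 /= /bump /=.
congr (toK (M _ _)).
case: (leqP j k) => h; case: (PeanoNat.Nat.ltb_spec k j) => //.
  by move/ssrnat.ltP; rewrite ltnNge h.
by move/ssrnat.leP; rewrite leqNgt h.
Qed.

Lemma is_eig_listE N M l : is_eig_list N M l <-> eigs (mx N M) (map toK l).
Proof.
have eM z : mx N (fun i j => Csub (if Nat.eqb i j then z else C0) (M i j)) = (toK z)%:M - mx N M.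
  apply/matrixP => i j; rewrite !mxE toKB; congr (_ - _).
  case: (PeanoNat.Nat.eqb_spec i j) => [/val_inj ->|h]; first by rewrite eqxx.
  by case: eqP => // ij; case: h; rewrite ij.
have eP z : toK (Cprod (List.map (fun lam => Csub z lam) l)) = \prod_(x <- map toK l) (toK z - x).
  by rewrite toK_prod -map_comp !big_map.
split=> -[sl e]; split.
- by rewrite size_map.
- by move=> z; rewrite -(ofKK z) -eM -toK_det e eP.
- by rewrite -sl size_map.
- by move=> z; apply: (can_inj toKK); rewrite toK_det eM e eP.
Qed.

Lemma is_eig_list_of_eigs N M l : eigs (mx N M) l -> is_eig_list N M (map ofK l).
Proof. by move=> h; apply/is_eig_listE; rewrite mapK //; apply: ofKK. Qed.

Lemma perm_Permutation (T : eqType) (s t : seq T) : perm_eq s t -> Permutation s t.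
Proof.
elim: s t => [|x s ih] t; first by rewrite perm_sym => /perm_nilP ->.
move=> h; have xt : x \in t by rewrite -(perm_mem h) mem_head.
case/path.splitPr: xt h => t1 t2 h.
apply: Permutation_cons_app; apply: ih.
by move: h; rewrite perm_sym -cat1s perm_catCA /= perm_cons perm_sym.
Qed.

Lemma eig_list_exists N M : exists l, is_eig_list N M l.
Proof.
by have [l hl] := eigs_exists (mx N M); exists (map ofK l); apply: is_eig_list_of_eigs.
Qed.

Lemma eig_list_Permutation N M l l' :
  is_eig_list N M l -> is_eig_list N M l' -> Permutation l l'.
Proof.
move=> /is_eig_listE h /is_eig_listE h'.
have e m : List.map ofK (map toK m) = m := mapK toKK m.
by have /perm_Permutation/(Permutation_map ofK) := eigs_perm h h'; rewrite !e.
Qed.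

(** * The spectra of [I_n + i A] and of [A^+] *)

Definition rmx N (A : Mat) : 'M[K]_N := \matrix_(i, j) toK (RtoC (A i j)).

Definition dI n : 'rV[K]_n.+1 := \row_j (j != ord0)%:R.

Lemma mx_ImA n A : mx n.+1 (ImA A) = diag_mx (dI n) + 'i *: rmx n.+1 A.
Proof.
apply/matrixP => i j; rewrite !mxE -toK_i -toKM.
have -> : (i != ord0)%:R *+ (i == j) =
    toK (if andb (Nat.eqb i j) (negb (Nat.eqb i 0)) then IZR 1 else IZR 0, IZR 0).
  case: (PeanoNat.Nat.eqb_spec i j) => [/val_inj ->|h] /=.
    rewrite eqxx mulr1n; case: (PeanoNat.Nat.eqb_spec j 0) => [/(@val_inj _ _ _ j ord0) -> //|h].
    by have -> : (j == ord0) = false by apply/eqP => e; apply: h; rewrite e.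
  by have -> : (i == j) = false by apply/eqP => e; apply: h; rewrite e.
by rewrite -toKD; congr Complex; rewrite /=; lra.
Qed.

Lemma herm_rmx N A : (forall i j, lt i N -> lt j N -> A i j = A j i) -> herm (rmx N A).
Proof.
move=> h; apply/matrixP => i j; rewrite !mxE -toKJ.
rewrite (h j i); try exact/ssrnat.ltP.
by congr Complex; rewrite /=; lra.
Qed.

Lemma herm_sym n A : is_sym n A -> herm (rmx n.+1 A).
Proof. by move=> h; apply: herm_rmx => i j hi hj; apply: h; apply/PeanoNat.Nat.lt_succ_r. Qed.

Lemma dI_ge0 n i : 0 <= dI n 0 i. Proof. by rewrite mxE ler0n. Qed.

Lemma toK_ge0 x : (0 <= toK (x, IZR 0)) = (0 <= x).
Proof. exact: lecR. Qed.

Lemma toK_gt0 x : (0 < toK (x, IZR 0)) = (0 < x).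
Proof. exact: ltcR. Qed.

Lemma In_mem (T : eqType) (x : T) (s : seq T) : List.In x s -> x \in s.
Proof. by elim: s => //= y s ih [->|/ih]; rewrite inE ?eqxx // => ->; rewrite orbT. Qed.

Lemma eigs_Forall_Re N (d : 'rV[K]_N) H l : (forall i, 0 <= d 0 i) -> herm H ->
  eigs (diag_mx d + 'i *: H) (map toK l) -> Forall (fun z => Rle (IZR 0) (fst z)) l.
Proof.
move=> hd hH h; apply/Forall_forall => z zl; apply/RleP; rewrite -toK_ge0 -toK_ReE.
by apply: (eigs_Re_ge0 hd hH h); apply: In_mem; apply: List.in_map.
Qed.

Lemma ImA_eig_Re_ge0 n A l : is_sym n A -> is_eig_list n.+1 (ImA A) l ->
  Forall (fun z => Rle (IZR 0) (fst z)) l.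
Proof.
move=> hA /is_eig_listE; rewrite mx_ImA => h.
exact: (eigs_Forall_Re (@dI_ge0 n) (herm_sym hA) h).
Qed.

(** For an eigenvector [v] at [0], the real part identity kills every coordinate but the first. So
    the first row of [I_n + i A] vanishes, and symmetry gives the first column. *)
Lemma ImA_eig_C0 n A l : is_sym n A -> is_eig_list n.+1 (ImA A) l ->
  List.In C0 l -> in_S n A.
Proof.
move=> hA /is_eig_listE h l0.
have {h l0} [v v0 e] := eigs_vec h (In_mem (List.in_map toK _ _ l0)).
have e' := e; rewrite mx_ImA in e'.
have := form_Re_eigs (fun i => ger0_real (@dI_ge0 n i)) (herm_sym hA) e'.
rewrite toK_ReE [toK _](_ : _ = 0) // mul0r => /esym/eqP.
rewrite psumr_eq0; last by move=> i _; rewrite mulr_ge0 ?exprn_ge0 ?dI_ge0.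
move=> /allP hv {e'}.
have vi i : i != ord0 -> v 0 i = 0.
  move=> i0; have := hv i (mem_index_enum _).
  by rewrite /= mxE i0 mul1r expf_eq0 /= normr_eq0 => /eqP.
have v00 : v 0 0 != 0.
  apply: contra v0 => /eqP z; apply/eqP/rowP => i; rewrite mxE.
  by case: (eqVneq i ord0) => [->|/vi].
have A0 (j : 'I_n.+1) : A 0%N j = IZR 0.
  have /rowP/(_ j) := e; rewrite [toK C0](_ : _ = 0) // scale0r !mxE (bigD1 0) //=.
  rewrite big1 => [|i /vi ->]; last by rewrite mul0r.
  rewrite addr0 mxE => /eqP; rewrite mulf_eq0 (negbTE v00) /= => /eqP.
  by rewrite /ImA; case.
have A0' j : le j n -> A 0%N j = IZR 0.
  by move/ssrnat.leP; rewrite -ltnS => hj; apply: (A0 (Ordinal hj)).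
split; first exact: A0' (PeanoNat.Nat.le_0_l n).
by move=> j [_ hj]; rewrite (hA j 0%N hj (PeanoNat.Nat.le_0_l n)) A0'.
Qed.

(** Multiplication by ['i] gives the form [diag_mx d + 'i *: H] with [d = 0], so ['i] times the
    eigenvalue has zero real part. *)
Lemma Aplus_eig_real n A l z : is_sym n A -> is_eig_list n (Aplus A) l ->
  List.In z l -> snd z = IZR 0.
Proof.
move=> hA /is_eig_listE h zl.
have {h zl} [v v0 e] := eigs_vec h (In_mem (List.in_map toK _ _ zl)).
have hH : herm (rmx n (fun i j => A i.+1 j.+1)).
  by apply: herm_rmx => i j hi hj; apply: hA.
have e' : v *m (diag_mx 0 + 'i *: rmx n (fun i j => A i.+1 j.+1)) = ('i * toK z) *: v.
  by rewrite raddf0 add0r -scalemxAr -scalerA -e.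
have r0 (i : 'I_n) : (0 : 'rV[K]_n) 0 i \is Num.real by rewrite mxE rpred0.
have := form_Re_eigs r0 hH e'; rewrite [RHS]big1; last by move=> i _; rewrite mxE mul0r.
move/eqP; rewrite mulf_eq0 (gt_eqF (sum_sqr_gt0 v0)) orbF ReMil oppr_eq0 toK_ImE => /eqP.
by case.
Qed.

(** The first row of [z - (I_n + i A)] is [(z, 0, ..., 0)], so the expansion has a single term. The
    head [C0] will account for the summand [PI / 2] in [Theta]. *)
Lemma ImA_eig_degenerate n A l : in_S n A -> is_eig_list n (Aplus A) l ->
  is_eig_list n.+1 (ImA A) (C0 :: map (fun z => Cadd C1 (Cmul (IZR 0, IZR 1) z)) l).
Proof.
move=> [A00 hS] /is_eig_listE h; apply/is_eig_listE.
have [sl e] := eigs_affine 1 (neq0Ci _) h.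
split=> [|z]; first by have := h.1; rewrite /= !size_map => ->.
rewrite (expand_det_row _ ord0) big_ord_recl big1 => [|j _]; last first.
  have hj : lt j n by apply/ssrnat.ltP.
  rewrite !mxE /= mulr0n sub0r /ImA /bump /= add1n.
  by have [-> _] := hS j.+1 (conj (PeanoNat.Nat.lt_0_succ _) hj);
    rewrite [toK _](_ : _ = 0) // oppr0 mul0r.
rewrite addr0 /= big_cons !mxE eqxx mulr1n /ImA /= A00; congr (_ * _).
rewrite /cofactor add0n expr0 mul1r.
have -> : row' ord0 (col' ord0 (z%:M - mx n.+1 (ImA A))) = z%:M - (1%:M + 'i *: mx n (Aplus A)).
  apply/matrixP => i j; rewrite !mxE (inj_eq (@lift_inj _ ord0)); congr (_ - _).
  rewrite -toK_i -toKM /ImA /= /bump /= !add1n /=.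
  case: (PeanoNat.Nat.eqb_spec i j) => [/val_inj ->|ij].
    by rewrite eqxx mulr1n [1](_ : _ = toK C1) // -toKD; congr Complex; rewrite /=; lra.
  have -> : (i == j) = false by apply/eqP => ji; apply: ij; rewrite ji.
  by rewrite mulr0n [0](_ : _ = toK C0) // -toKD; congr Complex; rewrite /=; lra.
by rewrite e !big_map.
Qed.

Definition scal (d : Rdefinitions.R) : Mat := fun i j => if Nat.eqb i j then d else IZR 0.

Lemma ImA_eig_shift n A d l : is_eig_list n.+1 (ImA A) l ->
  is_eig_list n.+1 (ImA (madd A (scal d))) (map (Cadd (IZR 0, d)) l).
Proof.
move=> /is_eig_listE h; apply/is_eig_listE.
have := eigs_affine (toK (IZR 0, d)) (oner_neq0 _) h; rewrite scale1r.
have -> : (toK (IZR 0, d))%:M + mx n.+1 (ImA A) = mx n.+1 (ImA (madd A (scal d))).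
  apply/matrixP => i j; rewrite !mxE /ImA /madd /scal.
  case: (PeanoNat.Nat.eqb_spec i j) => [/val_inj ->|ij].
    by rewrite eqxx mulr1n -toKD; congr Complex; rewrite /=; lra.
  have -> : (i == j) = false by apply/eqP => ji; apply: ij; rewrite ji.
  by rewrite mulr0n [0](_ : _ = toK C0) // -toKD; congr Complex; rewrite /=; lra.
rewrite -!map_comp (eq_map (g := toK \o Cadd (IZR 0, d))) // => x /=.
by rewrite mul1r.
Qed.

Lemma ImA_eig_opp n A l : is_eig_list n.+1 (ImA A) l ->
  is_eig_list n.+1 (ImA (mopp A)) (map Cconj l).
Proof.
move=> /is_eig_listE /eigs_conj h; apply/is_eig_listE.
move: h; rewrite -!map_comp; congr eigs.
by apply/matrixP => i j; rewrite !mxE -toKJ.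
Qed.

(** The real part of the trace; it yields an eigenvalue off the imaginary axis when [n >= 1]. *)
Lemma ImA_eig_trace n A l : is_eig_list n.+1 (ImA A) l -> lsum fst l = INR n.
Proof.
move=> /is_eig_listE /eigs_tr.
have -> : \sum_(x <- map toK l) x = toK (lsum fst l, lsum snd l).
  by elim: l => [|x l ih]; rewrite ?big_nil //= big_cons ih -toKD.
have sum1 N (f : 'I_N -> Rdefinitions.R) :
    \sum_(i < N) toK (IZR 1, f i) = toK (INR N, \sum_(i < N) f i).
  elim: N f => [|N ih] f; first by rewrite !big_ord0.
  by rewrite S_INR !big_ord_recr /= ih -toKD.
have -> : \tr (mx n.+1 (ImA A)) = toK (IZR 0, A 0%N 0%N) + \sum_(i < n) toK (IZR 1, A i.+1 i.+1).
  rewrite /mxtrace big_ord_recl mxE; congr (_ + _); apply: eq_bigr => i _.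
  by rewrite mxE /ImA /= /bump /= add1n /= PeanoNat.Nat.eqb_refl.
by rewrite sum1 -toKD => -[-> _]; rewrite /=; lra.
Qed.

(** For [v = x + i y] the form is real and equals [q x + q y], which carries positivity from real to
    complex vectors. *)
Lemma psd_form n P : psd n P -> forall v : 'rV[K]_n.+1, 0 <= (v *m rmx n.+1 P *m adj v) 0 0.
Proof.
move=> [sP hP] v.
have RsumE N (f : nat -> Rdefinitions.R) : Rsum N f = \sum_(i < N) f i.
  by elim: N => [|N ih]; rewrite ?big_ord0 // big_ord_recr /= ih.
rewrite -(Creal_ReP _ (herm_form_real v (herm_sym sP))).
pose q (x : nat -> Rdefinitions.R) :=
  Rsum n.+1 (fun i => Rsum n.+1 (fun j => Rmult (Rmult (x i) (P i j)) (x j))).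
pose x i := complex.Re (v 0 (inord i)); pose y i := complex.Im (v 0 (inord i)).
have -> : 'Re ((v *m rmx n.+1 P *m adj v) 0 0) = toK (Rplus (q x) (q y), IZR 0).
  rewrite mxE raddf_sum /=.
  transitivity (\sum_(j < n.+1) \sum_(i < n.+1)
      toK (Rplus (Rmult (Rmult (x i) (P i j)) (x j)) (Rmult (Rmult (y i) (P i j)) (y j)), IZR 0)).
    apply: eq_bigr => j _; rewrite !mxE big_distrl raddf_sum; apply: eq_bigr => i _ /=.
    rewrite !mxE -[v 0 i]ofKK -[v 0 j]ofKK -toKJ -!toKM toK_ReE; congr Complex.
    by rewrite /x /y !inord_val /=; lra.
  rewrite exchange_big /= /q !RsumE RplusE -big_split.
  transitivity (\sum_(i < n.+1) real_complex Rdefinitions.R (\sum_(j < n.+1)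
      Rplus (Rmult (Rmult (x i) (P i j)) (x j)) (Rmult (Rmult (y i) (P i j)) (y j)))).
    by apply: eq_bigr => i _; rewrite rmorph_sum.
  rewrite -rmorph_sum; congr Complex; apply: eq_bigr => i _.
  by rewrite !RsumE -big_split.
by rewrite toK_ge0; apply/RleP; apply: Rplus_le_le_0_compat; apply: hP.
Qed.

Lemma ang_mono n A P l l' : is_sym n A -> psd n P ->
  is_eig_list n.+1 (ImA A) l -> is_eig_list n.+1 (ImA (madd A P)) l' ->
  forall s, Rlt (IZR 0) s ->
  Rle (lsum (fun z => ang (Cadd (s, IZR 0) z)) l) (lsum (fun z => ang (Cadd (s, IZR 0) z)) l').
Proof.
move=> hA hP hl hl' s s0.
(* [Q] is about Hermitian matrices because the rank one terms of the spectral theorem may have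
   complex entries. *)
pose Q (H : 'M[K]_n.+1) := herm H /\ forall m, eigs (diag_mx (dI n) + 'i *: H) (map toK m) ->
  Rle (lsum (fun z => ang (Cadd (s, IZR 0) z)) l) (lsum (fun z => ang (Cadd (s, IZR 0) z)) m).
have Q0 : Q (rmx n.+1 A).
  split=> [|m hm]; first exact: herm_sym.
  rewrite (lsum_perm _ _ m); first exact: Rle_refl.
  by apply: (eig_list_Permutation hl); apply/is_eig_listE; rewrite mx_ImA.
have step H k (u : 'rV_n.+1) : 0 <= k -> Q H -> Q (H + k *: (adj u *m u)).
  move=> k0 [hH QH].
  have hH' : herm (H + k *: (adj u *m u)).
    rewrite raddfD /= map_mxD hH linearZ /= map_mxZ trmx_mul map_mxM /=.
    rewrite (CrealP (ger0_real k0)); congr (_ + k *: (_ *m _)).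
    by apply/matrixP => i j; rewrite !mxE conjCK.
  split=> // m hm.
  have [/eqP kz|knz] := boolP (k == 0); first by apply: QH; move: hm; rewrite kz scale0r addr0.
  have [/eqP uz|unz] := boolP (u == 0); first by apply: QH; move: hm; rewrite uz mulmx0 scaler0 addr0.
  have [m0 hm0] := eigs_exists (diag_mx (dI n) + 'i *: H).
  have em0 : m0 = map toK (map ofK m0) by rewrite mapK //; apply: ofKK.
  rewrite em0 in hm0; move: (map ofK m0) hm0 => {em0}m0 hm0.
  apply: Rle_trans (QH _ hm0) _; apply: Rlt_le; apply: lsum_ang_lt s0.
  - exact: eigs_Forall_Re (@dI_ge0 n) hH hm0.
  - exact: eigs_Forall_Re (@dI_ge0 n) hH' hm.
  move=> t t0; apply/RltP; rewrite -toK_gt0 -toK_ImE toKM toKJ.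
  have eP r : toK (Cprod (List.map (Cadd (t, IZR 0)) r))
      = \prod_(x <- map toK r) (toK (t, IZR 0) + x).
    by rewrite toK_prod -map_comp !big_map.
  rewrite !eP; apply: (rank1_Im_gt0 (@dI_ge0 n) hH _ unz _ hm0 hm).
    by rewrite lt_def knz.
  by rewrite toK_gt0; apply/RltP.
have [_] := psd_ind (herm_sym hP.1) (psd_form hP) step Q0; apply.
have -> : rmx n.+1 A + rmx n.+1 P = rmx n.+1 (madd A P).
  by apply/matrixP => i j; rewrite !mxE -toKD; congr Complex; rewrite /=; lra.
by rewrite -mx_ImA; apply/is_eig_listE.
Qed.

End Spectrum.

Import Spectrum.
Set Implicit Arguments.

(** * The space-time Lagrangian angle *)

(** Invariance under permutation removes the choice made by [eig_list]. On the degenerate set [C0]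
    contributes [PI / 2] and [1 + i x] contributes [atan x]; off it [0] is no eigenvalue, so [Carg]
    and [argp] agree. *)
Lemma Theta_lsum (n : nat) (A : Mat) (l : list C) :
  is_sym n A -> is_eig_list (S n) (ImA A) l -> Theta n A = lsum argp l.
Proof.
  intros HA Hl. unfold Theta.
  destruct (excluded_middle_informative (in_S n A)) as [HS|HS].
  - assert (He : is_eig_list n (Aplus A) (eig_list n (Aplus A)))
      by (unfold eig_list; apply epsilon_spec, eig_list_exists).
    pose proof (ImA_eig_degenerate HS He) as Hd.
    rewrite (lsum_perm _ _ _ (eig_list_Permutation Hl Hd)).
    change (PI / 2 + lsum (fun z => atan (fst z)) (eig_list n (Aplus A)) =
      argp C0 + lsum argp (map (fun z => Cadd C1 (Cmul (0, 1) z)) (eig_list n (Aplus A)))).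
    rewrite lsum_map. f_equal.
    + unfold argp, C0; simpl. destruct (Rlt_dec 0 0), (Rle_dec 0 0); lra.
    + apply lsum_eq. intros z Hz. pose proof (Aplus_eig_real HA He Hz) as Hr.
      destruct z as [x y]; simpl in Hr; subst y.
      unfold argp, ang, Cadd, C1, Cmul; simpl.
      destruct (Rlt_dec 0 (1 + (0 * x - 1 * 0))); [|lra]. f_equal. field.
  - assert (He : is_eig_list (S n) (ImA A) (eig_list (S n) (ImA A)))
      by (unfold eig_list; apply epsilon_spec, eig_list_exists).
    change (lsum Carg (eig_list (S n) (ImA A)) = lsum argp l).
    rewrite (lsum_perm _ _ _ (eig_list_Permutation He Hl)).
    apply lsum_eq. intros z Hz. apply Carg_argp.
    + pose proof (ImA_eig_Re_ge0 HA Hl) as HF. rewrite Forall_forall in HF. now apply HF.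
    + intros ->. apply HS. exact (ImA_eig_C0 HA Hl Hz).
Qed.

Lemma is_sym_madd (n : nat) (A B : Mat) : is_sym n A -> is_sym n B -> is_sym n (madd A B).
Proof. intros HA HB i j Hi Hj. unfold madd. now rewrite (HA i j), (HB i j). Qed.

Lemma is_sym_mopp (n : nat) (A : Mat) : is_sym n A -> is_sym n (mopp A).
Proof. intros HA i j Hi Hj. unfold mopp. now rewrite (HA i j). Qed.

Lemma is_sym_scal (n : nat) (d : R) : is_sym n (scal d).
Proof. intros i j _ _. unfold scal. now rewrite Nat.eqb_sym. Qed.

Lemma mopp_mopp (A : Mat) : mopp (mopp A) = A.
Proof. unfold mopp. do 2 (apply functional_extensionality; intro). apply Ropp_involutive. Qed.

Lemma madd_AC (A B D : Mat) : madd (madd A B) D = madd (madd A D) B.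
Proof. unfold madd. do 2 (apply functional_extensionality; intro). ring. Qed.

Lemma Theta_mono (n : nat) (A P : Mat) :
  is_sym n A -> psd n P -> Theta n A <= Theta n (madd A P).
Proof.
  intros HA HP.
  destruct (eig_list_exists (S n) (ImA A)) as [l Hl].
  destruct (eig_list_exists (S n) (ImA (madd A P))) as [l' Hl'].
  assert (HAP : is_sym n (madd A P)) by (apply is_sym_madd; [easy|apply HP]).
  rewrite (Theta_lsum HA Hl), (Theta_lsum HAP Hl').
  pose proof (ImA_eig_Re_ge0 HA Hl) as HF. pose proof (ImA_eig_Re_ge0 HAP Hl') as HF'.
  rewrite Forall_forall in HF, HF'.
  (* [ang_mono] requires a positive real shift: it is applied to [A + d I] with [s = d * d], and the
     limit recovers [argp] on both sides. *)
  set (f := fun d z => ang (Cadd (d * d, 0) (Cadd (0, d) z))).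
  apply (limit_le (fun d => lsum (f d) l) (fun d => lsum (f d) l')).
  - apply limit_lsum. intros z Hz. apply limit_ang_curve; auto.
  - apply limit_lsum. intros z Hz. apply limit_ang_curve; auto.
  - intros d Hd. unfold f.
    rewrite <- !(lsum_map (fun z => ang (Cadd (d * d, 0) z)) (Cadd (0, d))).
    apply (@ang_mono n (madd A (scal d)) P).
    + apply is_sym_madd; [easy|apply is_sym_scal].
    + easy.
    + now apply ImA_eig_shift.
    + rewrite madd_AC. now apply ImA_eig_shift.
    + nra.
Qed.

Lemma Theta_right_continuous (n : nat) (A : Mat) (a : R) :
  is_sym n A -> Theta n A < a ->
  exists d, 0 < d /\ Theta n (madd A (scal d)) < a.
Proof.
  intros HA Ha. destruct (eig_list_exists (S n) (ImA A)) as [l Hl].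
  rewrite (Theta_lsum HA Hl) in Ha.
  pose proof (ImA_eig_Re_ge0 HA Hl) as HF. rewrite Forall_forall in HF.
  assert (Hlim : limit1_in (fun d => lsum (fun z => argp (Cadd (0, d) z)) l)
            (Rlt 0) (lsum argp l) 0).
  { apply limit_lsum. intros z Hz. apply limit_argp_shift; auto. }
  destruct (Hlim (a - lsum argp l)) as [d [Hd H]]; [lra|].
  simpl in H. unfold Rdist in H.
  exists (d / 2). split; [lra|].
  specialize (H (d / 2)). rewrite Rabs_right in H by lra. specialize (H ltac:(lra)).
  apply Rabs_def2 in H.
  rewrite (Theta_lsum (is_sym_madd HA (@is_sym_scal n (d / 2))) (ImA_eig_shift (d / 2) Hl)), lsum_map.
  lra.
Qed.

Lemma Theta_opp_ge (n : nat) (A : Mat) : is_sym n A -> - Theta n (mopp A) <= Theta n A.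
Proof.
  intros HA. destruct (eig_list_exists (S n) (ImA (mopp A))) as [l Hl].
  pose proof (is_sym_mopp HA) as HA'.
  pose proof (ImA_eig_opp Hl) as Hl'. rewrite mopp_mopp in Hl'.
  rewrite (Theta_lsum HA' Hl), (Theta_lsum HA Hl'), lsum_map, <- lsum_opp.
  pose proof (ImA_eig_Re_ge0 HA' Hl) as HF. rewrite Forall_forall in HF.
  apply lsum_le. intros z Hz. apply argp_conj_ge; auto.
Qed.

Lemma Theta_opp (n : nat) (A : Mat) (l : list C) :
  is_sym n A -> is_eig_list (S n) (ImA A) l -> ~ In C0 l ->
  Theta n (mopp A) = - Theta n A.
Proof.
  intros HA Hl H0.
  rewrite (Theta_lsum HA Hl), (Theta_lsum (is_sym_mopp HA) (ImA_eig_opp Hl)), lsum_map, <- lsum_opp.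
  pose proof (ImA_eig_Re_ge0 HA Hl) as HF. rewrite Forall_forall in HF.
  apply lsum_eq. intros z Hz. apply argp_conj; [now intros ->|auto].
Qed.

(** * Nearby matrices and multiples of the identity *)

Lemma Rsum_le (N : nat) (f g : nat -> R) :
  (forall i, (i < N)%nat -> f i <= g i) -> Rsum N f <= Rsum N g.
Proof. induction N as [|N IH]; simpl; intros H; [lra|]. apply Rplus_le_compat; auto. Qed.

Lemma Rsum_eq (N : nat) (f g : nat -> R) :
  (forall i, (i < N)%nat -> f i = g i) -> Rsum N f = Rsum N g.
Proof. induction N as [|N IH]; simpl; intros H; [lra|]. rewrite IH, H; auto. Qed.

Lemma Rsum_plus (N : nat) (f g : nat -> R) :
  Rsum N (fun i => f i + g i) = Rsum N f + Rsum N g.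
Proof. induction N as [|N IH]; simpl; lra. Qed.

Lemma Rsum_scal (N : nat) (a : R) (f : nat -> R) :
  Rsum N (fun i => a * f i) = a * Rsum N f.
Proof. induction N as [|N IH]; simpl; lra. Qed.

Lemma Rsum_const (N : nat) (a : R) : Rsum N (fun _ => a) = INR N * a.
Proof. induction N as [|N IH]; [simpl; lra|]. rewrite S_INR. simpl Rsum. lra. Qed.

Lemma Rsum_delta (N : nat) (i : nat) (f : nat -> R) : (i < N)%nat ->
  Rsum N (fun j => if Nat.eqb i j then f j else 0) = f i.
Proof.
  induction N as [|N IH]; [lia|]; intros Hi; simpl.
  destruct (Nat.eqb_spec i N) as [->|Hne].
  - assert (E : forall M, (M <= N)%nat -> Rsum M (fun j => if Nat.eqb N j then f j else 0) = 0).
    { induction M as [|M IHM]; simpl; intros HM; [easy|].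
      rewrite IHM by lia. destruct (Nat.eqb_spec N M); [lia|lra]. }
    rewrite E by lia. lra.
  - rewrite IH by lia. lra.
Qed.

(** With [e = d / (n + 1)], each term of the form of [A - B] is at least
    [- (e / 2) (x_i^2 + x_j^2)]; these bounds add up to [- d |x|^2], which [d I] compensates. *)
Lemma psd_close (n : nat) (A B : Mat) (d : R) :
  is_sym n A -> is_sym n B -> 0 < d -> close n (d / INR (S n)) A B ->
  psd n (madd (madd A (mopp B)) (scal d)).
Proof.
  intros HA HB Hd Hc.
  assert (HN : 0 < INR (S n)) by apply lt_0_INR, Nat.lt_0_succ.
  set (N := S n) in *. set (e := d / INR N) in *.
  assert (He : INR N * e = d) by (unfold e; field; lra).
  split.
  { apply is_sym_madd; [|apply is_sym_scal]. apply is_sym_madd; [easy|now apply is_sym_mopp]. }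
  intros x.
  set (S2 := Rsum N (fun i => x i * x i)).
  assert (E1 : Rsum N (fun i => Rsum N (fun j =>
      - (e / 2) * (x i * x i + x j * x j) + (if Nat.eqb i j then d * (x j * x j) else 0))) = 0).
  { transitivity (Rsum N (fun i => - (e / 2) * (INR N * (x i * x i) + S2) + d * (x i * x i))).
    - apply Rsum_eq. intros i Hi. rewrite Rsum_plus, Rsum_scal, Rsum_plus, Rsum_const.
      now rewrite (Rsum_delta (fun j => d * (x j * x j)) Hi).
    - rewrite Rsum_plus, !Rsum_scal, Rsum_plus, Rsum_scal, Rsum_const. fold S2.
      rewrite <- He. field. }
  rewrite <- E1. apply Rsum_le. intros i Hi. apply Rsum_le. intros j Hj.
  specialize (Hc i j ltac:(unfold N in *; lia) ltac:(unfold N in *; lia)).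
  apply Rabs_def2 in Hc. unfold madd, mopp, scal.
  set (u := A i j + - B i j). assert (Hu : - e < u < e) by (unfold u; lra).
  assert (Hm : - (e / 2) * (x i * x i + x j * x j) <= x i * u * x j).
  { pose proof (Rle_0_sqr (x i + x j)). pose proof (Rle_0_sqr (x i - x j)). unfold Rsqr in *.
    nra. }
  destruct (Nat.eqb_spec i j) as [->|]; lra.
Qed.

(** [A + d I] is [B] plus a positive semidefinite matrix, so monotonicity stands in for continuity
    of [Theta] in the matrix. *)
Lemma Theta_close_le (n : nat) (A B : Mat) (d : R) :
  is_sym n A -> is_sym n B -> 0 < d -> close n (d / INR (S n)) A B ->
  Theta n B <= Theta n (madd A (scal d)).
Proof.
  intros HA HB Hd Hc.
  replace (madd A (scal d)) with (madd B (madd (madd A (mopp B)) (scal d))).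
  - apply Theta_mono; [easy|]. now apply psd_close.
  - unfold madd, mopp. do 2 (apply functional_extensionality; intro). ring.
Qed.

Lemma shift_avoids_C0 (l : list C) (eps : R) : 0 < eps ->
  exists d, 0 < d < eps /\ forall t, 0 < t <= d -> ~ In C0 (map (Cadd (0, t)) l).
Proof.
  intros He; induction l as [|[x y] l [d [Hd H]]]; simpl.
  - exists (eps / 2). split; [lra|tauto].
  (* An upward shift can reach the origin only from [y < 0], at [t = - y]; half of that stays short
     of it. *)
  - set (d' := if Rlt_dec y 0 then Rmin d (- y / 2) else d).
    assert (Hd' : 0 < d' <= d).
    { unfold d'. destruct (Rlt_dec y 0); [|lra].
      split; [apply Rmin_pos; lra|apply Rmin_l]. }
    exists d'. split; [lra|]. intros t Ht [E|Hin]; [|apply (H t); [lra|easy]].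
    unfold Cadd, C0 in E; simpl in E. injection E; intros E2 _.
    unfold d' in Ht. destruct (Rlt_dec y 0); [|lra].
    pose proof (Rmin_r d (- y / 2)). lra.
Qed.

Lemma Theta_shift_lt (n : nat) (A : Mat) (d : R) : (0 < n)%nat ->
  is_sym n A -> 0 < d -> Theta n A < Theta n (madd A (scal d)).
Proof.
  intros Hn HA Hd. destruct (eig_list_exists (S n) (ImA A)) as [l Hl].
  rewrite (Theta_lsum HA Hl),
    (Theta_lsum (is_sym_madd HA (@is_sym_scal n d)) (ImA_eig_shift d Hl)), lsum_map.
  pose proof (ImA_eig_Re_ge0 HA Hl) as HF. rewrite Forall_forall in HF.
  apply lsum_lt.
  - intros z Hz. apply argp_shift_le; [auto|lra].
  - destruct (classic (exists z, In z l /\ 0 < fst z)) as [[z [Hz Hp]]|Hno].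
    + exists z. split; [easy|]. now apply argp_shift_lt.
    + exfalso. pose proof (ImA_eig_trace Hl) as Ht.
      rewrite (lsum_eq fst (fun _ => 0)) in Ht.
      * rewrite lsum_cst, Rmult_0_r in Ht. apply lt_0_INR in Hn. lra.
      * intros z Hz. pose proof (HF z Hz). apply Rle_antisym; [|easy].
        apply Rnot_lt_le. intros Hp. apply Hno. eauto.
Qed.

(** The trace has real part [0], so the only eigenvalue lies on the imaginary axis. *)
Lemma Theta_dim0 (A : Mat) : is_sym 0 A -> Theta 0 A = PI / 2 \/ Theta 0 A = - (PI / 2).
Proof.
  intros HA. destruct (eig_list_exists 1 (ImA A)) as [l Hl].
  rewrite (Theta_lsum HA Hl). pose proof (ImA_eig_trace Hl) as Ht.
  destruct Hl as [Hlen _]. destruct l as [|[x y] [|]]; try discriminate.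
  unfold lsum in *; simpl in *. unfold argp; simpl.
  destruct (Rlt_dec 0 x); [lra|]. destruct (Rle_dec 0 y); [left|right]; lra.
Qed.

Lemma Theta_large (n : nat) (a : R) : a < INR (S n) * PI / 2 ->
  exists A, is_sym n A /\ a <= Theta n A.
Proof.
  intros Ha. destruct (eig_list_exists (S n) (ImA (scal 0))) as [l Hl].
  destruct (lsum_shift_pinfty l (INR (S n) * PI / 2 - a)) as [T HT]; [lra|].
  exists (madd (scal 0) (scal T)).
  assert (Hs : is_sym n (madd (scal 0) (scal T))) by (apply is_sym_madd; apply is_sym_scal).
  split; [easy|].
  rewrite (Theta_lsum Hs (ImA_eig_shift T Hl)), lsum_map.
  specialize (HT T ltac:(lra)). rewrite (proj1 Hl) in HT. lra.
Qed.

Lemma Theta_small (n : nat) (a : R) : - (INR (S n) * PI / 2) < a ->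
  exists A, is_sym n A /\ Theta n A < a.
Proof.
  intros Ha. destruct (eig_list_exists (S n) (ImA (scal 0))) as [l Hl].
  destruct (lsum_shift_minfty l (a + INR (S n) * PI / 2)) as [T HT]; [lra| |].
  { exact (ImA_eig_Re_ge0 (@is_sym_scal n 0) Hl). }
  exists (madd (scal 0) (scal (- T))).
  assert (Hs : is_sym n (madd (scal 0) (scal (- T)))) by (apply is_sym_madd; apply is_sym_scal).
  split; [easy|].
  rewrite (Theta_lsum Hs (ImA_eig_shift (- T) Hl)), lsum_map.
  specialize (HT T ltac:(lra)). rewrite (proj1 Hl) in HT. lra.
Qed.

(** * The subequation property and the dual *)

Lemma Fc_subequation (n : nat) (c : R) :
  Rabs c < INR (S n) * PI / 2 -> subequation n (Fc n c).
Proof.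
  intros Hc. apply Rabs_def2 in Hc. split; [|split; [|split; [|split]]].
  - now intros A [HA _].
  - destruct (@Theta_large n c) as [A [HA H]]; [lra|]. exists A. split; [easy|lra].
  - destruct (@Theta_small n c) as [A [HA H]]; [lra|]. exists A. split; [easy|].
    intros [_ H']. lra.
  (* If [Theta A < c], some [A + d I] also has angle below [c], and it bounds the angle of every
     symmetric matrix close to [A]. *)
  - intros A HA H. split; [easy|]. apply Rnot_lt_ge. intros Hlt.
    destruct (Theta_right_continuous HA Hlt) as [d [Hd Hd']].
    destruct (H (d / INR (S n))) as [B [[HB HBc] Hcl]].
    { apply Rdiv_lt_0_compat; [easy|]. apply lt_0_INR, Nat.lt_0_succ. }
    pose proof (Theta_close_le HA HB Hd Hcl). lra.
  - intros A P [HA H] HP. split; [apply is_sym_madd; [easy|apply HP]|].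
    pose proof (Theta_mono HA HP). lra.
Qed.

Lemma close_mopp_l (n : nat) (eps : R) (A B : Mat) :
  close n eps (mopp A) B -> close n eps A (mopp B).
Proof.
  intros H i j Hi Hj. specialize (H i j Hi Hj). unfold mopp in *.
  rewrite <- Rabs_Ropp. now replace (- (A i j - - B i j)) with (- A i j - B i j) by ring.
Qed.

Lemma dual_Fc (n : nat) (c : R) (A : Mat) :
  Rabs c < INR (S n) * PI / 2 -> (dual n (Fc n c) A <-> Fc n (- c) A).
Proof.
  intros Hc. apply Rabs_def2 in Hc. split; intros [HA H]; split; try easy.
  (* If [Theta A < - c], then for [B] near [- A] the chain [Theta B >= - Theta (- B) >= - Theta (A +
     d I) > c] makes [- A] interior. *)
  - apply Rnot_lt_ge. intros Hlt. apply H.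
    destruct (Theta_right_continuous HA Hlt) as [d [Hd Hd']].
    exists (d / INR (S n)). split.
    { apply Rdiv_lt_0_compat; [easy|]. apply lt_0_INR, Nat.lt_0_succ. }
    intros B HB Hcl. split; [easy|].
    pose proof (Theta_close_le HA (is_sym_mopp HB) Hd (close_mopp_l Hcl)).
    pose proof (Theta_opp_ge HB). lra.
  (* The test matrix is [- (A + d I)], within [eps] of [- A], with [d] chosen so that [A + d I] has
     no eigenvalue producing a defect of oddness. Membership then gives
     [Theta (A + d I) <= - c <= Theta A], against strict growth when [n >= 1]. *)
  - intros [eps [Heps Hint]].
    destruct (eig_list_exists (S n) (ImA A)) as [l Hl].
    destruct (shift_avoids_C0 l Heps) as [d [Hd Hav]].
    pose proof (is_sym_madd HA (@is_sym_scal n d)) as HA'.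
    pose proof (Theta_opp HA' (ImA_eig_shift d Hl) (Hav d ltac:(lra))) as Hopp.
    destruct (Hint (mopp (madd A (scal d)))) as [_ HB].
    + now apply is_sym_mopp.
    + intros i j _ _. unfold mopp, madd, scal.
      destruct (Nat.eqb i j).
      * replace (- A i j - - (A i j + d)) with d by ring. rewrite Rabs_right; lra.
      * replace (- A i j - - (A i j + 0)) with 0 by ring. rewrite Rabs_R0; lra.
    + destruct n as [|n].
      * (* In dimension one [Theta] is locally constant, so strict monotonicity
           fails; the bound on [c] excludes both of its values instead. *)
        assert (Theta 0 A <= Theta 0 (madd A (scal d))).
        { apply Theta_close_le; try easy. intros i j _ _.
          rewrite Rminus_diag, Rabs_R0. simpl. lra. }
        simpl in Hc. destruct (Theta_dim0 HA), (Theta_dim0 HA'); lra.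
      * pose proof (Theta_shift_lt (Nat.lt_0_succ n) HA (proj1 Hd)). lra.
Qed.

Theorem theorem5p1 (n : nat) (c : R) :
  Rabs c < INR (S n) * PI / 2 ->
  subequation n (Fc n c) /\
  (forall A : Mat, dual n (Fc n c) A <-> Fc n (- c) A).
Proof.
  intros Hc. split; [now apply Fc_subequation|].
  intros A. now apply dual_Fc.
Qed.
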